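(* Let $n\geq 4$ and let $A$ and $B$ be two $n\times n$ generalized tournament matrices. Suppose that $A$ is indecomposable. If $A$ and $B$ have equal corresponding principal minors of orders at most $4$, then $A=B$ or $A=B^{t}$.
   Context: A generalized tournament matrix of order $n$ is a real $n\times n$ matrix $M=(m_{ij})$ with nonnegative entries satisfying $M+M^{t}=J_n-I_n$ ($J_n$ the all-ones matrix, $I_n$ the identity). Write $[n]=\{1,\ldots,n\}$. A clan of $M$ is a subset $X\subseteq[n]$ such that for all $i,j\in X$ and $k\in[n]\setminus X$, $m_{ik}=m_{jk}$ and $m_{ki}=m_{kj}$. The empty set, singletons and $[n]$ are the trivial clans; $M$ is indecomposable if all its clans are trivial. *)

(* Defs.v *)
From mathcomp Require Import all_boot all_order all_algebra.
From mathcomp Require Import reals.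
Set Implicit Arguments. Unset Strict Implicit. Unset Printing Implicit Defensive.
Import Order.TTheory GRing.Theory Num.Theory.
Local Open Scope ring_scope.

Definition gen_tournament (R : realType) (n : nat) (M : 'M[R]_n) : Prop :=
  (forall i j, 0 <= M i j) /\
  (forall i j, M i j + M j i = (if i == j then 0 else 1)).

Definition clan (R : realType) (n : nat) (M : 'M[R]_n) (X : {set 'I_n}) : Prop :=
  forall i j k, i \in X -> j \in X -> k \notin X ->
    M i k = M j k /\ M k i = M k j.

Definition trivial_set (n : nat) (X : {set 'I_n}) : Prop :=
  X = set0 \/ #|X| = 1%N \/ X = setT.

Definition indecomposable (R : realType) (n : nat) (M : 'M[R]_n) : Prop :=
  forall X : {set 'I_n}, clan M X -> trivial_set X.

Definition principal_submx (R : realType) (n : nat) (M : 'M[R]_n)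
  (X : {set 'I_n}) : 'M[R]_#|X| :=
  \matrix_(i, j) M (enum_val i) (enum_val j).

Definition principal_minor (R : realType) (n : nat) (M : 'M[R]_n)
  (X : {set 'I_n}) : R := \det (principal_submx M X).

(* Main.v *)
Require Import Defs.
From mathcomp Require Import all_boot all_order all_algebra all_fingroup.
From mathcomp Require Import reals ring lra.
Set Implicit Arguments. Unset Strict Implicit. Unset Printing Implicit Defensive.
Import GRing.Theory Num.Theory.
Local Open Scope ring_scope.

(** Let [s := A - A^T] and [t := B - B^T]. The minors of order 2 give
    [t i j = +- s i j], so every pair with [s i j != 0] gets one of two colors:
    [p] (same sign) or [m] (opposite sign). The minors of order 3 forbid triangles
    with one [p] edge, one [m] edge and one uncolored pair, and in a triangle with
    exactly one edge of the other color the ends of that edge see the third vertex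
    with the same value of [s]. Hence the components of each color are clans, so if
    both colors occur and [A] is indecomposable, both color graphs are connected.
    Then some four vertices induce a path in each color; the minor of order 4
    makes [|s|] constant there and yields a cut: a bipartition [(X, Y)] with
    [s x y = u] for all [x] in [X] and [y] in [Y]. A set carrying a cut and connected
    in both colors is either a clan or can be enlarged by a vertex that sees it in
    both colors, and the cut extends. A cut of the whole vertex set has a side that
    is a nontrivial clan: contradiction. *)

(** * Two-colorings *)

(* In [col_pathp] and [col_pathm], [a b c d] is an induced path in one color, hence
   [c a d b] is one in the other. *)
Record coloring (T : finType) (V : zmodType) (s : T -> T -> V) (p m : rel T)
    : Prop := Coloring {
  col_skew : forall i j, s i j = - s j i;
  col_diag : forall i, s i i = 0;
  col_symp : symmetric p;
  col_symm : symmetric m;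
  col_disj : forall i j, p i j -> m i j -> False;
  col_supp : forall i j, p i j || m i j = (s i j != 0);
  col_rainbow : forall i j k, p i j -> m i k -> s j k = 0 -> False;
  col_trip : forall i j k, p i k -> p j k -> m i j -> s i k = s j k;
  col_trim : forall i j k, m i k -> m j k -> p i j -> s i k = s j k;
  col_pathp : forall a b c d, p a b -> p b c -> p c d ->
    m a c -> m b d -> m a d -> s a d = s a b \/ s a d = - s a b;
  col_pathm : forall a b c d, m a b -> m b c -> m c d ->
    p a c -> p b d -> p a d -> s a d = s a b \/ s a d = - s a b
}.

Lemma coloring_swap (T : finType) (V : zmodType) (s : T -> T -> V) (p m : rel T) :
  coloring s p m -> coloring s m p.
Proof.
case=> skew diag symp symm disj supp rb tp tm pp pm; split=> //.
- by move=> i j mij pij; apply: disj pij mij.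
- by move=> i j; rewrite orbC.
- by move=> i j k mij pik /eqP; rewrite skew oppr_eq0 => /eqP; exact: rb pik mij.
Qed.

(** * Extending a cut by one vertex *)

Section Growth.

Variables (T : finType) (V : zmodType) (s : T -> T -> V).

Definition cut (u : V) (X Y : {set T}) : Prop :=
  [/\ X != set0, Y != set0 & {in X & Y, forall x y, s x y = u}].

Section OneVertex.

Variables (p m : rel T) (C : coloring s p m).
Variables (u : V) (X Y : {set T}) (v : T).
Hypothesis XYu : cut u X Y.
Hypothesis u0 : u != 0.

Let skew := col_skew C.
Let symp := col_symp C.
Let symm := col_symm C.

Lemma color_pm i j : s i j != 0 -> p i j \/ m i j.
Proof. by rewrite -(col_supp C) => /orP. Qed.

Lemma color3 i j : [\/ p i j, m i j | s i j = 0].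
Proof.
case: (eqVneq (s i j) 0) => [|/color_pm[]]; first by constructor 3.
  by constructor 1.
by constructor 2.
Qed.

Lemma pC i j : p i j -> p j i.
Proof. by rewrite symp. Qed.

Lemma mC i j : m i j -> m j i.
Proof. by rewrite symm. Qed.

Lemma s0C i j : s i j = 0 -> s j i = 0.
Proof. by move=> sij; rewrite skew sij oppr0. Qed.

Lemma sN i j w : s i j = w -> s j i = - w.
Proof. by move=> <-; apply: skew. Qed.

Lemma cut_edge x y : x \in X -> y \in Y -> p x y \/ m x y.
Proof.
by case: XYu => _ _ sXY xX yY; apply: color_pm; rewrite sXY.
Qed.

(** The vertices of [X] compatible with adding [v] to [Y]; [high] is the counterpart for adding [v]
    to [X]. *)
Definition low := [set x in X | s v x == - u].
Definition high := [set y in Y | s v y == u].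

Lemma lowP x : reflect (x \in X /\ s v x = - u) (x \in low).
Proof. by rewrite inE; apply: (iffP andP) => -[xX /eqP]. Qed.

Lemma nlowP x : reflect (x \in X /\ s v x <> - u) (x \in X :\: low).
Proof.
rewrite !inE; apply: (iffP idP).
  by case xX: (x \in X); rewrite ?andbF //= andbT => /eqP.
by case=> -> /eqP/negPf ->.
Qed.

Lemma nhighP y : reflect (y \in Y /\ s v y <> u) (y \in Y :\: high).
Proof.
rewrite !inE; apply: (iffP idP).
  by case yY: (y \in Y); rewrite ?andbF //= andbT => /eqP.
by case=> -> /eqP/negPf ->.
Qed.

(** Whatever the color of [x y], the triangle [v x y] has exactly one edge of the other color; the
    triangle rule then carries the value of the cut to [v] and puts [x] in [low] or [y] in
    [high]. *)
Lemma nlow_nhigh_pm x y : x \in X :\: low -> y \in Y :\: high ->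
  p v x -> m v y -> False.
Proof.
move=> /nlowP[xX vx] /nhighP[yY vy] pvx mvy.
have sxy : s x y = u by case: XYu => _ _; apply.
case: (cut_edge xX yY) => xy.
  apply: vx; rewrite (col_trip C pvx (pC xy) mvy).
  exact: sN.
apply: vy; rewrite -sxy.
by apply: (col_trim C mvy xy).
Qed.

Lemma nlow_nhigh_mp x y : x \in X :\: low -> y \in Y :\: high ->
  m v x -> p v y -> False.
Proof.
move=> /nlowP[xX vx] /nhighP[yY vy] mvx pvy.
have sxy : s x y = u by case: XYu => _ _; apply.
case: (cut_edge xX yY) => xy; last first.
  apply: vx; rewrite (col_trim C mvx (mC xy) pvy).
  exact: sN.
apply: vy; rewrite -sxy.
by apply: (col_trip C pvy xy).
Qed.

(** By the two preceding lemmas [v y] is uncolored, so [x y] must be [p] and [x' y] must be [m].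
    Then either color of [x x'] transfers the value of the cut through two triangles and puts [x] or
    [x'] in [low]. *)
Lemma nlow_pm x x' y : x \in X :\: low -> x' \in X :\: low ->
  y \in Y :\: high -> p v x -> m v x' -> False.
Proof.
move=> xP x'P yQ pvx mvx'.
have vy0 : s v y = 0.
  case: (color3 v y) => // vy.
    by case: (nlow_nhigh_mp x'P yQ).
  by case: (nlow_nhigh_pm xP yQ).
move/nlowP: (xP) => [xX vx]; move/nlowP: (x'P) => [x'X vx'].
move/nhighP: yQ => [yY _].
have sX z : z \in X -> s z y = u by case: XYu => _ _ sXY zX; apply: sXY.
have pxy : p x y.
  case: (cut_edge xX yY) => // mxy.
  by case: (col_rainbow C (pC pvx) mxy vy0).
have mx'y : m x' y.
  case: (cut_edge x'X yY) => // px'y.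
  by case: (col_rainbow C px'y (mC mvx') (s0C vy0)).
case: (color3 x x') => xx'.
- apply: vx; rewrite (col_trip C pvx (pC xx') mvx').
  rewrite -(col_trip C (pC pxy) (pC xx') (mC mx'y)).
  by apply: sN; apply: sX.
- apply: vx'; rewrite (col_trim C mvx' xx' pvx).
  rewrite -(col_trim C (mC mx'y) xx' (pC pxy)).
  by apply: sN; apply: sX.
- exact: (col_rainbow C pvx mvx' xx').
Qed.

(* The new cut separates the vertices of [low] seen by [v] in color [m]; the vertices
   of [low] joined to one of them by [p] must be on the same side. *)
Definition low_part := [set x in low | m v x || [exists n in low, m v n && p n x]].

Lemma low_part_cut : [exists n in low, m v n] ->
  (forall n w, n \in low -> m v n -> w \in X :\: low -> m n w /\ s n w = u) ->
  cut u low_part ((v |: (X :|: Y)) :\: low_part).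
Proof.
move=> /existsP[n0 /andP[n0L mn0]] good.
have sXY : {in X & Y, forall x y, s x y = u} by case: XYu.
(* First the vertices [n] seen by [v] in color [m]. A [w] in [low] but outside [low_part] is seen by
   [v] in color [p] and not joined to [n] by [p], so [n w] has color [m]; [good] covers the [w]
   outside [low]. *)
have stepN n w : n \in low -> m v n -> w \in X :\: low_part ->
    m n w /\ s n w = u.
  move=> nL mvn; rewrite in_setD => /andP[wM wX].
  case: (boolP (w \in low)) => wL; last by apply: good; rewrite // in_setD wL.
  move: wM; rewrite inE wL /= negb_or => /andP[mvw].
  rewrite negb_exists => /forallP /(_ n); rewrite nL mvn /= => pnw.
  have [_ svn] := lowP _ nL; have [_ svw] := lowP _ wL.
  have pvw : p v w.
    by case: (color_pm (i := v) (j := w)) => //;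
       rewrite ?svw ?oppr_eq0 // => mvw'; rewrite mvw' in mvw.
  have mnw : m n w.
    case: (color3 n w) => [h|//|h]; first by rewrite h in pnw.
    by case: (col_rainbow C pvw mvn (s0C h)).
  split=> //; rewrite -[RHS]opprK -svn; apply: sN.
  by rewrite -(col_trim C mvn (mC mnw) pvw).
(* Then the vertices [k] pulled in by an edge [n k] of color [p]: their value comes from [n] through
   the triangles [v n k] and [n k w]. *)
have step k w : k \in low_part -> w \in X :\: low_part -> s k w = u.
  rewrite inE => /andP[kL /orP[mvk|/existsP[n /and3P[nL mvn pnk]]]] wX.
    by have [] := stepN _ _ kL mvk wX.
  have [mnw snw] := stepN _ _ nL mvn wX.
  have [_ svn] := lowP _ nL; have [_ svk] := lowP _ kL.
  have [mvk|mvk] := boolP (m v k); first by have [] := stepN _ _ kL mvk wX.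
  have pvk : p v k.
    by case: (color_pm (i := v) (j := k)) => //;
       rewrite ?svk ?oppr_eq0 // => mvk'; rewrite mvk' in mvk.
  have snk : s n k = - u by rewrite -(col_trip C pvk pnk mvn).
  case: (color3 k w) => kw.
  - apply: (@etrans _ _ (- s w k)); first exact: skew.
    by rewrite -(col_trip C pnk (pC kw) mnw) snk opprK.
  - by rewrite -(col_trim C mnw kw pnk).
  - by case: (col_rainbow C pnk mnw kw).
have MX k : k \in low_part -> k \in X /\ s v k = - u.
  by rewrite inE => /andP[/lowP].
split.
- by apply/set0Pn; exists n0; rewrite inE n0L mn0.
- apply/set0Pn; exists v; rewrite in_setD setU11 andbT.
  apply/negP => /MX[_]; rewrite (col_diag C) => /eqP.
  by rewrite eq_sym oppr_eq0 (negPf u0).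
move=> k w kM; rewrite in_setD in_setU1 in_setU => /andP[wM /or3P[/eqP->|wX|wY]].
- by have [_ /sN] := MX _ kM; rewrite opprK.
- by apply: step; rewrite // in_setD wM.
- by have [kX _] := MX _ kM; apply: sXY.
Qed.

Lemma low_nhigh_m n y : n \in low -> m v n -> y \in Y :\: high ->
  ~~ m v y -> m n y.
Proof.
move=> /lowP[nX svn] mvn /nhighP[yY svy] mvy.
have sny : s n y = u by case: XYu => _ _; apply.
case: (cut_edge nX yY) => // pny.
case: (color3 v y) => vy.
- by case: svy; rewrite -sny; apply: (col_trip C vy pny).
- by rewrite vy in mvy.
- by case: (col_rainbow C pny (mC mvn) (s0C vy)).
Qed.

(** The hard case is [n w] of color [p]. If [w y] is [p], triangles put [w] in [low]. Otherwise
    [v n y w] is an induced path of color [m], and the path rule gives [s v w = - u], which puts [w]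
    in [low], or [s v w = u], which puts [y] in [high]. *)
Lemma low_nlow_p n w y : n \in low -> m v n -> w \in X :\: low ->
  y \in Y :\: high -> ~~ m v y -> p v w -> m n w /\ s n w = u.
Proof.
move=> nL mvn wP yQ mvy pvw.
have mny := low_nhigh_m nL mvn yQ mvy.
have [nX svn] := lowP _ nL; have [wX svw] := nlowP _ wP.
have [yY svy] := nhighP _ yQ.
have [sny swy] : s n y = u /\ s w y = u by case: XYu => _ _ sXY; rewrite !sXY.
case: (color3 n w) => nw; last first.
- by case: (col_rainbow C pvw mvn (s0C nw)).
- split=> //; apply: (@etrans _ _ (- s w n)); first exact: skew.
  by rewrite -(col_trim C mvn (mC nw) pvw) svn opprK.
case: svw.
have svwE : s v w = s n w by apply: (col_trip C pvw nw).
case: (cut_edge wX yY) => wy.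
  rewrite svwE (col_trip C nw (pC wy) mny).
  exact: sN.
case: (color3 v y) => vy; last first.
- by case: (col_rainbow C (pC pvw) wy vy).
- by rewrite vy in mvy.
have swyE : s v w = s v y.
  by rewrite skew (col_trip C (pC pvw) (pC vy) wy) -skew.
have [//|] := col_pathm C mvn mny (mC wy) vy nw pvw.
  by rewrite svn.
by rewrite svn opprK swyE => /svy.
Qed.

Lemma low_nlow_0 n w y : n \in low -> m v n -> w \in X :\: low ->
  y \in Y :\: high -> ~~ m v y -> s v w = 0 -> p w y -> m n w /\ s n w = u.
Proof.
move=> nL mvn wP yQ mvy vw0 pwy.
have mny := low_nhigh_m nL mvn yQ mvy.
have [nX svn] := lowP _ nL; have [wX svw] := nlowP _ wP.
have [yY svy] := nhighP _ yQ.
have [sny swy] : s n y = u /\ s w y = u by case: XYu => _ _ sXY; rewrite !sXY.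
case: (color3 n w) => nw.
- by case: (col_rainbow C nw (mC mvn) (s0C vw0)).
- split=> //; apply: (@etrans _ _ (- s w n)); first exact: skew.
  rewrite (col_trim C (mC nw) (mC mny) pwy).
  by rewrite (sN sny) opprK.
- by case: (col_rainbow C (pC pwy) (mC mny) (s0C nw)).
Qed.

(** When [w y] has color [m], rainbow triangles force [w' y] and [w' w] to be [p] and [n w] to be
    [m]; the value at [w] is then read off from [w'] in the triangle [n w w']. *)
Lemma low_nlow_0p n w w' y : n \in low -> m v n -> w \in X :\: low ->
  w' \in X :\: low -> y \in Y :\: high -> ~~ m v y ->
  s v w = 0 -> p v w' -> m n w /\ s n w = u.
Proof.
move=> nL mvn wP w'P yQ mvy vw0 pvw'.
have mny := low_nhigh_m nL mvn yQ mvy.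
have [mnw' snw'] := low_nlow_p nL mvn w'P yQ mvy pvw'.
have [wX svw] := nlowP _ wP; have [w'X svw'] := nlowP _ w'P.
have [yY svy] := nhighP _ yQ.
case: (cut_edge wX yY) => wy; first exact: (low_nlow_0 nL mvn wP yQ mvy).
have wv0 : s w v = 0 by rewrite skew vw0 oppr0.
have vy0 : s v y = 0.
  case: (color3 v y) => // vy; last by rewrite vy in mvy.
  by case: (col_rainbow C (pC vy) (mC wy) vw0).
have pw'y : p w' y.
  case: (cut_edge w'X yY) => // w'y.
  by case: (col_rainbow C (pC pvw') w'y vy0).
have pw'w : p w' w.
  case: (color3 w' w) => // w'w.
    by case: (col_rainbow C (pC pvw') w'w vw0).
  by case: (col_rainbow C (pC pw'y) (mC wy) w'w).
have mnw : m n w.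
  case: (color3 n w) => // nw.
    by case: (col_rainbow C nw (mC mvn) wv0).
  by case: (col_rainbow C pw'w (mC mnw') (s0C nw)).
split=> //; rewrite -snw' skew [RHS]skew; congr (- _).
exact: (col_trim C (mC mnw) (mC mnw') (pC pw'w)).
Qed.

End OneVertex.

Lemma cut_rev (p m : rel T) (u : V) (X Y : {set T}) :
  coloring s p m -> cut u X Y -> cut (- u) Y X.
Proof.
by move=> C [X0 Y0 sXY]; split=> // y x yY xX; rewrite (col_skew C) sXY.
Qed.

Lemma low_opp (u : V) (Y : {set T}) v : low (- u) Y v = high u Y v.
Proof. by apply/setP => y; rewrite !inE opprK. Qed.

Lemma high_opp (u : V) (X : {set T}) v : high (- u) X v = low u X v.
Proof. by apply/setP => y; rewrite !inE. Qed.

(** * Absorption and the extended cut *)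

Definition has_cut (W : {set T}) : Prop :=
  exists u X Y, [/\ u != 0, cut u X Y & X :|: Y = W].

(** The second hypothesis of [low_part_cut] as a boolean, so that its failure yields explicit
    witnesses. *)
Definition absorbs (m : rel T) (u : V) (X : {set T}) v : bool :=
  [forall n in low u X v, forall w in X :\: low u X v,
     m v n ==> (m n w && (s n w == u))].

Lemma absorbsP (m : rel T) (u : V) (X : {set T}) v :
  reflect (forall n w, n \in low u X v -> m v n -> w \in X :\: low u X v ->
             m n w /\ s n w = u)
          (absorbs m u X v).
Proof.
apply: (iffP forall_inP) => [H n w nL mvn wP|H n nL].
  by have /forall_inP/(_ w wP) := H n nL; rewrite mvn => /andP[-> /eqP].
apply/forall_inP => w wP; apply/implyP => mvn.
by have [-> ->] := H n w nL mvn wP; rewrite eqxx.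
Qed.

Lemma nabsorbsP (m : rel T) (u : V) (X : {set T}) v :
  ~~ absorbs m u X v -> exists n w, [/\ n \in low u X v, m v n,
    w \in X :\: low u X v & ~ (m n w /\ s n w = u)].
Proof.
rewrite negb_forall_in => /exists_inP[n nL].
rewrite negb_forall_in => /exists_inP[w wP]; rewrite negb_imply => /andP[mvn nok].
exists n, w; split=> // -[mnw snw]; by rewrite mnw snw eqxx in nok.
Qed.

Lemma absorbs_has_cut (p m : rel T) (u : V) (X Y : {set T}) v n :
  coloring s p m -> cut u X Y -> u != 0 ->
  n \in low u X v -> m v n -> absorbs m u X v -> has_cut (v |: (X :|: Y)).
Proof.
move=> C XYu u0 nL mvn /absorbsP H.
have nE : [exists n in low u X v, m v n] by apply/existsP; exists n; rewrite nL.
exists u, (low_part p m u X v), ((v |: (X :|: Y)) :\: low_part p m u X v).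
split; [by []|exact: (low_part_cut C XYu u0 nE H)|].
apply/setP => z; rewrite in_setU in_setD.
case: (boolP (z \in low_part _ _ _ _ _)) => //=.
by rewrite !inE => /andP[/andP[-> _] _]; rewrite orbT.
Qed.

Lemma absorbs_has_cut_rev (p m : rel T) (u : V) (X Y : {set T}) v n :
  coloring s p m -> cut u X Y -> u != 0 ->
  n \in high u Y v -> m v n -> absorbs m (- u) Y v -> has_cut (v |: (X :|: Y)).
Proof.
move=> C XYu u0 nH mvn A; rewrite (setUC X).
apply: (absorbs_has_cut C (cut_rev C XYu) _ _ mvn A); first by rewrite oppr_eq0.
by rewrite low_opp.
Qed.

(** * A vertex uncolored towards everything outside [low] and [high] *)

Section ZeroCase.

Variables (u : V) (X Y : {set T}) (v y0 : T).
Hypothesis XYu : cut u X Y.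
Hypothesis u0 : u != 0.
Hypothesis y0Q : y0 \in Y :\: high u Y v.
Hypothesis P0 : forall x, x \in X :\: low u X v -> s v x = 0.
Hypothesis Q0 : forall y, y \in Y :\: high u Y v -> s v y = 0.

Lemma zero_nm (p m : rel T) x : coloring s p m -> s v x = 0 -> ~~ m v x.
Proof.
by move=> C vx0; have := col_supp C v x; rewrite vx0 eqxx; case: (m v x); rewrite ?orbT.
Qed.

(** Contrapositive of [low_nlow_0]: a [p] edge from [w] to a vertex of [Y] outside [high] would
    repair the failure of absorption at [w]. *)
Lemma nabsorbs_nlow (p m : rel T) n w : coloring s p m ->
    n \in low u X v -> m v n -> w \in X :\: low u X v ->
    ~ (m n w /\ s n w = u) ->
  forall y, y \in Y :\: high u Y v -> m w y.
Proof.
move=> C nL mvn wP nok y yQ.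
have [[wX _] [yY _]] := (nlowP _ _ _ _ wP, nhighP _ _ _ _ yQ).
case: (cut_edge C XYu u0 wX yY) => // wy.
case: nok; apply: (low_nlow_0 C XYu u0 nL mvn wP yQ _ _ wy); last exact: P0.
exact: zero_nm C (Q0 yQ).
Qed.

(** If absorption failed in both colors, the failing vertices [a] and [b] would be joined to [y0] by
    [m] and by [p]. So [a b] is colored, and its color transfers the good value from [b] to [a] or
    from [a] to [b], repairing one failure. *)
Lemma absorbs_low (p m : rel T) : coloring s p m ->
  absorbs m u X v || absorbs p u X v.
Proof.
move=> C; apply/norP => -[/nabsorbsP[n [a [nL mvn aP na]]]].
move=> /nabsorbsP[k [b [kL pvk bP kb]]].
have C' := coloring_swap C.
have may := nabsorbs_nlow C nL mvn aP na; have pby := nabsorbs_nlow C' kL pvk bP kb.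
have vy0 := zero_nm C (Q0 y0Q); have vy0' := zero_nm C' (Q0 y0Q).
have [mnb snb] := low_nlow_0 C XYu u0 nL mvn bP y0Q vy0 (P0 bP) (pby _ y0Q).
have [pka ska] := low_nlow_0 C' XYu u0 kL pvk aP y0Q vy0' (P0 aP) (may _ y0Q).
have va0 := s0C C (P0 aP).
case: (color3 C a b) => ab.
- case: na; case: (color3 C n a) => na'.
  + by case: (col_rainbow C na' (mC C mvn) va0).
  + by split=> //; rewrite -snb (col_skew C) [RHS](col_skew C)
      (col_trim C (mC C na') (mC C mnb) ab).
  + by case: (col_rainbow C (pC C ab) (mC C mnb) (s0C C na')).
- case: kb; case: (color3 C k b) => kb'.
  + by split=> //; rewrite -ska (col_skew C) [RHS](col_skew C)
      (col_trip C (pC C kb') (pC C pka) (mC C ab)).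
  + by case: (col_rainbow C (pC C pvk) kb' (P0 bP)).
  + by case: (col_rainbow C (pC C pka) ab kb').
- by case: (col_rainbow C (pC C (pby _ y0Q)) (mC C (may _ y0Q)) (s0C C ab)).
Qed.

End ZeroCase.
(** Two failures, at [a] in [X] and at [b] in [Y], would give the edge [a b] both colors. *)
Lemma absorbs_low_high (p m : rel T) (u : V) (X Y : {set T}) v :
  coloring s p m -> cut u X Y -> u != 0 ->
  (forall x, x \in X :\: low u X v -> s v x = 0) ->
  (forall y, y \in Y :\: high u Y v -> s v y = 0) ->
  absorbs m u X v || absorbs p (- u) Y v.
Proof.
move=> C XYu u0 P0 Q0; apply/norP => -[/nabsorbsP[n [a [nL mvn aP na]]]].
move=> /nabsorbsP[k [b [kH pvk bQ kb]]].
have may := nabsorbs_nlow XYu u0 P0 Q0 C nL mvn aP na.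
have pby : forall y, y \in X :\: high (- u) X v -> p b y.
  apply: (nabsorbs_nlow (cut_rev C XYu) _ _ _ (coloring_swap C) kH pvk bQ kb).
  - by rewrite oppr_eq0.
  - by move=> y; rewrite low_opp; apply: Q0.
  - by move=> x; rewrite high_opp; apply: P0.
rewrite low_opp in bQ; rewrite high_opp in pby.
exact: (col_disj C (pby _ aP) (mC C (may _ bQ))).
Qed.

(** Absorption in color [m] holds: for [w] uncolored towards [v], the vertex [w0] plays the role of
    [w'] in [low_nlow_0p] if it lies in [X]; if it lies in [Y], that of [y] in [low_nlow_0]. *)
Lemma grow_low (p m : rel T) (u : V) (X Y : {set T}) v n y0 w0 :
  coloring s p m -> cut u X Y -> u != 0 -> y0 \in Y :\: high u Y v ->
  (forall w, w \in (X :\: low u X v) :|: (Y :\: high u Y v) -> ~~ m v w) ->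
  w0 \in (X :\: low u X v) :|: (Y :\: high u Y v) -> p v w0 ->
  n \in low u X v -> m v n -> has_cut (v |: (X :|: Y)).
Proof.
move=> C XYu u0 y0Q nm w0PQ pvw0 nL mvn.
have nmQ y : y \in Y :\: high u Y v -> ~~ m v y.
  by move=> yQ; apply: nm; rewrite in_setU yQ orbT.
apply: (absorbs_has_cut C XYu u0 nL mvn); apply/absorbsP => {nL mvn}n w nL mvn wP.
case: (color3 C v w) => vw.
- exact: (low_nlow_p C XYu u0 nL mvn wP y0Q (nmQ _ y0Q) vw).
- by have := nm w; rewrite in_setU wP vw => /(_ isT).
move: w0PQ; rewrite in_setU => /orP[w0P|w0Q].
  exact: (low_nlow_0p C XYu u0 nL mvn wP w0P y0Q (nmQ _ y0Q) vw pvw0).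
have [[wX _] [w0Y _]] := (nlowP _ _ _ _ wP, nhighP _ _ _ _ w0Q).
case: (cut_edge C XYu u0 wX w0Y) => ww0.
  exact: (low_nlow_0 C XYu u0 nL mvn wP w0Q (nmQ _ w0Q) vw ww0).
by case: (col_rainbow C (pC C pvw0) (mC C ww0) vw).
Qed.

(** The vertex [n], being seen in color [m], lies in [low] or [high]; the second case is the first
    one for the reversed cut with value [- u]. *)
Lemma grow_mono (p m : rel T) (u : V) (X Y : {set T}) v n x0 y0 w0 :
  coloring s p m -> cut u X Y -> u != 0 ->
  x0 \in X :\: low u X v -> y0 \in Y :\: high u Y v ->
  (forall w, w \in (X :\: low u X v) :|: (Y :\: high u Y v) -> ~~ m v w) ->
  w0 \in (X :\: low u X v) :|: (Y :\: high u Y v) -> p v w0 ->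
  n \in X :|: Y -> m v n -> has_cut (v |: (X :|: Y)).
Proof.
move=> C XYu u0 x0P y0Q nm w0PQ pvw0 nXY mvn.
have : n \in low u X v :|: high u Y v.
  move: (nm n) nXY; rewrite mvn !inE.
  case: (n \in X); case: (n \in Y); case: (s v n == - u);
    by case: (s v n == u) => //= /(_ isT).
rewrite in_setU => /orP[nL|nH].
  exact: (grow_low C XYu u0 y0Q nm w0PQ pvw0 nL mvn).
rewrite (setUC X).
apply: (@grow_low p m (- u) Y X v n x0 w0 C (cut_rev C XYu)) => //.
- by rewrite oppr_eq0.
- by move=> w; rewrite low_opp high_opp setUC; apply: nm.
- by rewrite low_opp high_opp setUC.
- by rewrite low_opp.
Qed.

Lemma nlow_nhigh_mono (p m : rel T) (u : V) (X Y : {set T}) v x0 y0 w w' :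
  coloring s p m -> cut u X Y -> u != 0 ->
  x0 \in X :\: low u X v -> y0 \in Y :\: high u Y v ->
  w \in (X :\: low u X v) :|: (Y :\: high u Y v) ->
  w' \in (X :\: low u X v) :|: (Y :\: high u Y v) ->
  p v w -> ~~ m v w'.
Proof.
move=> C XYu u0 x0P y0Q; rewrite !(in_setU _ (_ :\: _)).
move=> /orP[wP|wQ] /orP[w'P|w'Q] pvw; apply/negP => mvw'.
- exact: (nlow_pm C XYu u0 wP w'P y0Q pvw mvw').
- exact: (nlow_nhigh_pm C XYu u0 wP w'Q pvw mvw').
- exact: (nlow_nhigh_mp C XYu u0 w'P wQ mvw' pvw).
- apply: (@nlow_pm p m C (- u) Y X v (cut_rev C XYu) _ w w' x0) => //.
  + by rewrite oppr_eq0.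
  + by rewrite low_opp.
  + by rewrite low_opp.
Qed.

(** Both [a] and [b] lie in [low] or [high]. Wherever they lie, absorption holds in color [p] on the
    side of [a] or in color [m] on the side of [b]. *)
Lemma grow_zero (p m : rel T) (u : V) (X Y : {set T}) v y0 x0 a b :
  coloring s p m -> cut u X Y -> u != 0 ->
  x0 \in X :\: low u X v -> y0 \in Y :\: high u Y v ->
  (forall x, x \in X :\: low u X v -> s v x = 0) ->
  (forall y, y \in Y :\: high u Y v -> s v y = 0) ->
  a \in X :|: Y -> p v a -> b \in X :|: Y -> m v b ->
  has_cut (v |: (X :|: Y)).
Proof.
move=> C XYu u0 x0P y0Q P0 Q0 aXY pva bXY mvb.
have C' := coloring_swap C.
have LH c : c \in X :|: Y -> s v c != 0 -> c \in low u X v \/ c \in high u Y v.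
  rewrite in_setU => /orP[cX|cY] svc.
    have [|cL] := boolP (c \in low u X v); first by left.
    by case/eqP: svc; apply: P0; rewrite in_setD cL.
  have [|cH] := boolP (c \in high u Y v); first by right.
  by case/eqP: svc; apply: Q0; rewrite in_setD cH.
have C0 := cut_rev C XYu.
have u0' : - u != 0 by rewrite oppr_eq0.
have highA : absorbs m (- u) Y v || absorbs p (- u) Y v.
  apply: (@absorbs_low (- u) Y X v x0 C0) => // y.
  by rewrite low_opp; apply: Q0.
have [aL|aH] : a \in low u X v \/ a \in high u Y v.
- by apply: LH => //; rewrite -(col_supp C) pva.
- have [bL|bH] : b \in low u X v \/ b \in high u Y v.
  + by apply: LH => //; rewrite -(col_supp C) mvb orbT.
  + case/orP: (absorbs_low XYu u0 y0Q P0 Q0 C) => A.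
      exact: (absorbs_has_cut C XYu u0 bL mvb A).
    exact: (absorbs_has_cut C' XYu u0 aL pva A).
  + case/orP: (absorbs_low_high C' XYu u0 P0 Q0) => A.
      exact: (absorbs_has_cut C' XYu u0 aL pva A).
    exact: (absorbs_has_cut_rev C XYu u0 bH mvb A).
- have [bL|bH] : b \in low u X v \/ b \in high u Y v.
  + by apply: LH => //; rewrite -(col_supp C) mvb orbT.
  + case/orP: (absorbs_low_high C XYu u0 P0 Q0) => A.
      exact: (absorbs_has_cut C XYu u0 bL mvb A).
    exact: (absorbs_has_cut_rev C' XYu u0 aH pva A).
  + case/orP: highA => A.
      exact: (absorbs_has_cut_rev C XYu u0 bH mvb A).
    exact: (absorbs_has_cut_rev C' XYu u0 aH pva A).
Qed.

(** The vertex [v] joins a side of the cut if it fits there. Otherwise vertices outside [low] and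
    [high] exist on both sides, and the cases are that [v] sees some of them in color [p], some in
    color [m], or none at all. *)
Lemma grow (p m : rel T) (W : {set T}) v a b :
  coloring s p m -> has_cut W ->
  a \in W -> p v a -> b \in W -> m v b -> has_cut (v |: W).
Proof.
move=> C [u [X [Y [u0 XYu <-]]]] aXY pva bXY mvb.
have C' := coloring_swap C; have [X0 Y0 sXY] := XYu.
have [/subsetP XL|/subsetPn[x0 x0X x0L]] := boolP (X \subset low u X v).
  exists u, X, (v |: Y); split=> //; last by rewrite setUCA.
  split=> //; first by apply/set0Pn; exists v; rewrite setU11.
  move=> x y xX; rewrite in_setU1 => /orP[/eqP->|]; last exact: sXY.
  by have [_ svx] := lowP _ _ _ _ (XL x xX); rewrite (col_skew C) svx opprK.
have [/subsetP YH|/subsetPn[y0 y0Y y0H]] := boolP (Y \subset high u Y v).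
  exists u, (v |: X), Y; split=> //; last by rewrite setUA.
  split=> //; first by apply/set0Pn; exists v; rewrite setU11.
  move=> x y; rewrite in_setU1 => /orP[/eqP-> yY|xX yY]; last exact: sXY.
  by have := YH y yY; rewrite inE yY => /eqP.
have x0P : x0 \in X :\: low u X v by rewrite in_setD x0L.
have y0Q : y0 \in Y :\: high u Y v by rewrite in_setD y0H.
set PQ := (X :\: low u X v) :|: (Y :\: high u Y v).
have [/exists_inP[w wPQ pvw]|np] := boolP [exists w in PQ, p v w].
  apply: (grow_mono C XYu u0 x0P y0Q _ wPQ pvw bXY mvb) => w' w'PQ.
  exact: (nlow_nhigh_mono C XYu u0 x0P y0Q wPQ w'PQ pvw).
have [/exists_inP[w wPQ mvw]|nm] := boolP [exists w in PQ, m v w].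
  apply: (grow_mono C' XYu u0 x0P y0Q _ wPQ mvw aXY pva) => w' w'PQ.
  exact: (nlow_nhigh_mono C' XYu u0 x0P y0Q wPQ w'PQ mvw).
have PQ0 w : w \in PQ -> s v w = 0.
  move=> wPQ; case: (color3 C v w) => // vw.
    by case/exists_inP: np; exists w.
  by case/exists_inP: nm; exists w.
apply: (grow_zero C XYu u0 x0P y0Q) aXY pva bXY mvb => w wPQ; apply: PQ0.
  by rewrite in_setU wPQ.
by rewrite in_setU wPQ orbT.
Qed.

(** * Connectedness in both colors *)

Definition crossed (e : rel T) (X Y : {set T}) : bool :=
  [exists x in X, exists y in Y, e x y].

Lemma crossedP (e : rel T) (X Y : {set T}) :
  reflect (exists x y, [/\ x \in X, y \in Y & e x y]) (crossed e X Y).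
Proof.
apply: (iffP exists_inP) => [[x xX /exists_inP[y yY exy]]|[x [y [xX yY exy]]]].
  by exists x, y.
by exists x => //; apply/exists_inP; exists y.
Qed.

(** Connectedness of the graph induced on [W], stated through crossing edges because these are what
    the arguments extract. *)
Definition conn (e : rel T) (W : {set T}) : bool :=
  [forall X : {set T}, (X != set0) && (X \proper W) ==> crossed e X (W :\: X)].

Lemma connP (e : rel T) (W : {set T}) :
  reflect (forall X, X != set0 -> X \proper W ->
             exists x y, [/\ x \in X, y \in W :\: X & e x y])
          (conn e W).
Proof.
apply: (iffP forallP) => H X; last by apply/implyP => /andP[X0 XW]; apply/crossedP/H.
by move=> X0 XW; apply/crossedP; have /implyP := H X; apply; rewrite X0.
Qed.

Lemma conn1 (e : rel T) a : conn e [set a].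
Proof.
apply/connP => X X0 /proper_card; rewrite cards1 ltnS leqn0 cards_eq0.
by rewrite (negPf X0).
Qed.

Lemma connU1 (e : rel T) (W : {set T}) v w :
  symmetric e -> conn e W -> w \in W -> e v w -> conn e (v |: W).
Proof.
move=> esym /connP Wc wW evw; apply/connP => X X0 XvW.
have [XW0|XW0] := eqVneq (X :&: W) set0.
  have XnW x : x \in X -> x \notin W.
    by move=> xX; apply/negP => xW; have := in_set0 x; rewrite -XW0 inE xX xW.
  have [x xX] := set0Pn _ X0.
  have : x \in v |: W by apply: (subsetP (proper_sub XvW)).
  rewrite in_setU1 (negPf (XnW x xX)) orbF => /eqP xv.
  exists v, w; rewrite -{1}xv; split=> //; rewrite in_setD in_setU1 wW orbT andbT.
  by apply/negP => /XnW; rewrite wW.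
have [WX|WX] := boolP (W \subset X).
  have [_ [y yvW yX]] := properP XvW.
  move: (yvW); rewrite in_setU1 => /orP[/eqP yv|yW]; last first.
    by rewrite (subsetP WX y yW) in yX.
  exists w, y; split; first exact: (subsetP WX).
    by rewrite in_setD yX.
  by rewrite esym yv.
have [|x [y [xXW yWX exy]]] := Wc (X :&: W) XW0.
- by rewrite properE subsetIr /=; apply: contra WX; rewrite subsetI => /andP[].
move: xXW yWX; rewrite !inE => /andP[xX xW] /andP[yXW yW].
exists x, y; split=> //; rewrite !inE yW orbT andbT.
by rewrite yW andbT in yXW.
Qed.

(** * Four vertices inducing a path in each color *)

Definition has_P4 (p m : rel T) : Prop := exists a b c d,
  [/\ p a b, p b c, p c d & [/\ m a c, m b d & m a d]].

Lemma has_P4_swap (p m : rel T) : coloring s p m -> has_P4 m p -> has_P4 p m.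
Proof.
move=> C [a [b [c [d [mab mbc mcd [pac pbd pad]]]]]].
exists c, a, d, b; do ?split=> //; do ?[exact: (pC C) | exact: (mC C)].
Qed.

(** A [p] edge [x y] leaving the set of [m]-neighbors of [v] in [X] must end in [X], at a
    [p]-neighbor of [v]. No [p] edge joins [X] to [Y], so rainbow triangles make [x d] and [y d] of
    color [m], and [x y v d] is the path. *)
Lemma P4_of_split (p m : rel T) (X Y : {set T}) v z d :
  coloring s p m -> conn p (v |: (X :|: Y)) -> v \notin X -> ~~ crossed p X Y ->
  z \in X -> m v z -> d \in Y -> p v d -> has_P4 p m.
Proof.
move=> C /connP pW vX nXY zX mvz dY pvd.
pose Z := [set x in X | m v x].
have npXY x y : x \in X -> y \in Y -> ~~ p x y.
  by move=> xX yY; apply/negP => pxy; case/crossedP: nXY; exists x, y.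
have [||x [y [xZ yZ pxy]]] := pW Z.
- by apply/set0Pn; exists z; rewrite inE zX.
- apply/properP; split.
    by apply/subsetP => x; rewrite !inE => /andP[-> _]; rewrite orbT.
  by exists v; rewrite ?setU11 // inE (negPf vX).
have [xX mvx] : x \in X /\ m v x by move: xZ; rewrite inE => /andP[].
move: yZ; rewrite !inE => /andP[nmvy /or3P[/eqP yv|yX|yY]].
- by rewrite yv in pxy; case: (col_disj C (pC C pxy) mvx).
- have pvy : p v y.
    case: (color3 C v y) => // vy; first by rewrite yX vy in nmvy.
    by case: (col_rainbow C pxy (mC C mvx) (s0C C vy)).
  have mxd : m x d.
    case: (color3 C x d) => // xd; first by rewrite (negPf (npXY _ _ xX dY)) in xd.
    by case: (col_rainbow C pvd mvx (s0C C xd)).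
  have myd : m y d.
    case: (color3 C y d) => // yd; first by rewrite (negPf (npXY _ _ yX dY)) in yd.
    by case: (col_rainbow C pxy mxd yd).
  exists x, y, v, d; split=> //; first exact: (pC C).
  by split=> //; apply: (mC C).
- by rewrite (negPf (npXY _ _ xX yY)) in pxy.
Qed.

(** Since [W] is connected in both colors, [v] has [p]-neighbors on both sides of the separation and
    an [m]-neighbor on one of them; [P4_of_split] applies with that side first. *)
Lemma P4_of_disconnected (p m : rel T) (W : {set T}) v :
  coloring s p m -> conn p W -> conn m W -> v \in W -> ~~ conn p (W :\ v) ->
  has_P4 p m.
Proof.
move=> C pW mW vW; rewrite negb_forall => /existsP[X].
rewrite negb_imply => /andP[/andP[X0 XWv] nXY].
set Y := W :\ v :\: X in nXY.
have XW : X \subset W by apply: subset_trans (proper_sub XWv) (subD1set _ _).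
have vX : v \notin X.
  by apply/negP => /(subsetP (proper_sub XWv)); rewrite !inE eqxx.
have vY : v \notin Y by rewrite !inE eqxx andbF.
have WE : W = v |: (X :|: Y).
  apply/setP => z; rewrite !inE; case: eqP => [-> //|_] /=.
  by case zX: (z \in X) => //=; apply: (subsetP XW).
have nYX : ~~ crossed p Y X.
  apply/negP => /crossedP[y [x [yY xX pyx]]].
  by case/crossedP: nXY; exists x, y; split=> //; apply: (pC C).
have Y0 : Y != set0.
  by have [_ [y yW yX]] := properP XWv; apply/set0Pn; exists y; rewrite in_setD yX.
have sub_edge X' Y' : X' != set0 -> v \notin X' -> W = v |: (X' :|: Y') ->
    ~~ crossed p X' Y' -> exists2 x, x \in X' & p v x.
  move=> X'0 vX' WE' nX'; have [|x [y [xX yX pxy]]] := connP _ _ pW X' X'0.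
    apply/properP; split; last by exists v.
    by rewrite WE'; apply/subsetP => x xX; rewrite !inE xX orbT.
  move: yX; rewrite WE' !inE => /andP[/negPf-> /orP[/eqP yv|/= yY]].
    by exists x => //; rewrite -yv; apply: (pC C).
  by case/crossedP: nX'; exists x, y.
have WE' : W = v |: (Y :|: X) by rewrite (setUC Y).
have [x xX pvx] := sub_edge X Y X0 vX WE nXY.
have [y yY pvy] := sub_edge Y X Y0 vY WE' nYX.
have [||v' [z [/set1P-> zW mvz]]] := connP _ _ mW [set v].
- by apply/set0Pn; exists v; rewrite set11.
- apply/properP; split; first by rewrite sub1set.
  by exists x; [apply: (subsetP XW) | apply/set1P => xv; rewrite -xv xX in vX].
move: zW; rewrite {1}WE !in_setD in_setU1 in_setU.
move=> /andP[/set1P zv /or3P[/eqP//|zX|zY]].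
  by apply: (@P4_of_split p m X Y v z y) => //; rewrite -WE.
by apply: (@P4_of_split p m Y X v z x) => //; rewrite -WE'.
Qed.

(** Vertices are removed while both colors stay connected; the first removal that disconnects one
    gives the path. Reaching a single vertex is impossible, as the last edge would have both
    colors. *)
Lemma has_P4_of_conn (p m : rel T) (W : {set T}) :
  coloring s p m -> conn p W -> conn m W -> (1 < #|W|)%N -> has_P4 p m.
Proof.
move=> C; have [k] := ubnP #|W|; elim: k W => // k IHk W leWk pW mW W1.
have [v vW] : exists v, v \in W by apply/card_gt0P; apply: ltnW.
have [pW'|pW'] := boolP (conn p (W :\ v));
  last exact: (P4_of_disconnected C pW mW vW pW').
have [mW'|mW'] := boolP (conn m (W :\ v)); last first.
  apply: (has_P4_swap C).
  exact: (P4_of_disconnected (coloring_swap C) mW pW vW mW').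
have cW := cardsD1 v W; rewrite vW add1n in cW.
have [W'1|W'1] := ltnP 1 #|W :\ v|.
  by apply: IHk pW' mW' W'1; rewrite -ltnS -cW.
have /cards1P[w Ww] : #|W :\ v| == 1%N by rewrite eqn_leq W'1 -ltnS -cW.
have edge e : conn e W -> e v w.
  move=> /connP eW; have [||x [y [/set1P-> yW]]] := eW [set v].
  - by apply/set0Pn; exists v; rewrite set11.
  - apply/properP; split; first by rewrite sub1set.
    have : w \in W :\ v by rewrite Ww set11.
    by rewrite in_setD => /andP[wv wW]; exists w.
  by move: yW; rewrite Ww => /set1P->.
by case: (col_disj C (edge p pW) (edge m mW)).
Qed.

Lemma P4_cut (p m : rel T) : coloring s p m -> has_P4 p m ->
  exists W, [/\ conn p W, conn m W & has_cut W].
Proof.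
move=> C [a [b [c [d [pab pbc pcd [mac mbd mad]]]]]].
exists (d |: (c |: (b |: [set a]))); split.
- apply: (connU1 (col_symp C) _ _ (pC C pcd)); last by rewrite !inE eqxx.
  apply: (connU1 (col_symp C) _ _ (pC C pbc)); last by rewrite !inE eqxx.
  apply: (connU1 (col_symp C) _ _ (pC C pab)); last by rewrite inE.
  exact: conn1.
- have -> : d |: (c |: (b |: [set a])) = b |: (d |: (a |: [set c])).
    by apply/setP => z; rewrite !inE; do 4!case: (_ == _).
  apply: (connU1 (col_symm C) _ _ mbd); last by rewrite !inE eqxx.
  apply: (connU1 (col_symm C) _ _ (mC C mad)); last by rewrite !inE eqxx.
  apply: (connU1 (col_symm C) _ _ mac); last by rewrite inE.
  exact: conn1.
have sab0 : s a b != 0 by rewrite -(col_supp C) pab.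
have sbc : s b c = - s a b by rewrite (col_skew C) (col_trip C pab (pC C pbc) mac).
have sbd : s b d = s a d by rewrite (col_trim C mad mbd pab).
have sac : s a c = s a d.
  by rewrite (col_skew C) (col_trim C (mC C mac) (mC C mad) pcd) -(col_skew C).
(* By the path rule, either [a] has the same value towards [b], [c], [d], or [b] has the same value
   towards [a], [c], [d]. *)
case: (col_pathp C pab pbc pcd mac mbd mad) => sad.
  exists (s a b), [set a], [set b; c; d]; split=> //; last first.
    by apply/setP => z; rewrite !inE; do 4!case: (_ == _).
  split; [by apply/set0Pn; exists a; rewrite set11| |].
    by apply/set0Pn; exists b; rewrite !inE eqxx.
  by move=> x y /set1P->; rewrite !inE => /orP[/orP[]|] /eqP->; rewrite ?sac ?sad.
exists (- s a b), [set b], [set a; c; d]; split=> //; first by rewrite oppr_eq0.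
  split; [by apply/set0Pn; exists b; rewrite set11| |].
    by apply/set0Pn; exists a; rewrite !inE eqxx.
  move=> x y /set1P->; rewrite !inE => /orP[/orP[]|] /eqP->; rewrite ?sbc ?sbd ?sad //.
  exact: (col_skew C).
by apply/setP => z; rewrite !inE; do 4!case: (_ == _).
Qed.

(** * Clans and cuts of the whole vertex set *)

Lemma not_mixed (p m : rel T) (W : {set T}) v i j :
  coloring s p m -> conn m W -> (forall w, w \in W -> ~~ m v w) ->
  i \in W -> j \in W -> s i v = s j v.
Proof.
move=> C /connP mW nm iW jW; apply/eqP/negPn/negP => sij.
(* Along an [m] edge [x y] of [W], [v] sees both ends in color [p] or neither, so the value cannot
   change. *)
have [||x [y [xX yX mxy]]] := mW [set x in W | s x v == s i v].
- by apply/set0Pn; exists i; rewrite inE iW /=.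
- apply/properP; split; first by apply/subsetP => x; rewrite inE => /andP[].
  by exists j; rewrite // inE jW /= eq_sym.
move: xX yX; rewrite !inE => /andP[xW /eqP sxv] /andP[+ yW].
rewrite yW -sxv => /eqP; apply.
have nx := nm _ xW; have ny := nm _ yW.
case: (color3 C v x) => vx; first last.
- case: (color3 C v y) => vy; first last.
  + by rewrite (s0C C vx) (s0C C vy).
  + by rewrite vy in ny.
  + by case: (col_rainbow C (pC C vy) (mC C mxy) vx).
- by rewrite vx in nx.
case: (color3 C v y) => vy; first last.
- by case: (col_rainbow C (pC C vx) mxy vy).
- by rewrite vy in ny.
exact: (col_trip C (pC C vy) (pC C vx) (mC C mxy)).
Qed.

Definition prime_skew : Prop := forall X : {set T},
  (forall i j k, i \in X -> j \in X -> k \notin X -> s i k = s j k) ->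
  X = set0 \/ #|X| = 1%N \/ X = setT.

(** A vertex seeing [W] in both colors enlarges it by [grow]. If there is none, [W] is a clan by
    [not_mixed], and its nonzero cut excludes the empty set and singletons. *)
Lemma has_cut_setT (p m : rel T) (W : {set T}) :
  coloring s p m -> prime_skew -> conn p W -> conn m W -> has_cut W ->
  has_cut setT.
Proof.
move=> C primes; have [k] := ubnP #|~: W|.
elim: k W => // k IHk W leWk pW mW cutW.
have C' := coloring_swap C.
have [/exists_inP[v vW /andP[/exists_inP[a aW pva] /exists_inP[b bW mvb]]]|nmix] :=
  boolP [exists v in ~: W, [exists a in W, p v a] && [exists b in W, m v b]].
  apply: (IHk (v |: W)).
  - rewrite -ltnS; apply: leq_trans leWk; rewrite ltnS; apply: proper_card.
    apply/properP; split; first by rewrite setCS subsetUr.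
    by exists v; rewrite // inE setU11.
  - exact: (connU1 (col_symp C) pW aW pva).
  - exact: (connU1 (col_symm C) mW bW mvb).
  - exact: (grow C cutW aW pva bW mvb).
have [i j v iW jW vW||] := primes W.
- have nm (q : rel T) : ~~ [exists a in W, q v a] -> forall w, w \in W -> ~~ q v w.
    by move=> /exists_inPn nq w wW; apply: nq.
  move/exists_inPn/(_ v): nmix; rewrite inE vW => /(_ isT).
  rewrite negb_and => /orP[/nm np|/nm nmm].
    exact: (not_mixed C' pW np iW jW).
  exact: (not_mixed C mW nmm iW jW).
- by case: cutW => u [X [Y [_ [/set0Pn[x xX] _ _] <-]]] /setP/(_ x); rewrite !inE xX.
case=> [/eqP/cards1P[w Ww]|<- //].
case: cutW => u [X [Y [u0 [/set0Pn[x xX] /set0Pn[y yY] sXY] XYW]]].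
have /set1P xw : x \in [set w] by rewrite -Ww -XYW in_setU xX.
have /set1P yw : y \in [set w] by rewrite -Ww -XYW in_setU yY orbT.
by case/eqP: u0; rewrite -(sXY x y xX yY) xw yw (col_diag C).
Qed.

(** The [p]-component of [a] is a clan: a vertex outside it sees both ends of a [p] edge in color
    [m], with equal values, or neither end. *)
Lemma conn_setT (p m : rel T) a b :
  coloring s p m -> prime_skew -> p a b -> conn p setT.
Proof.
move=> C primes pab.
have pathE q x k : path p x q -> ~~ connect p x k -> s (last x q) k = s x k.
  elim: q x => //= y q IHq x /andP[pxy pq] nxk.
  have nyk : ~~ connect p y k.
    by apply: contra nxk; apply: connect_trans (connect1 pxy).
  rewrite IHq //.
  have npx : ~~ p x k by apply: contra nxk => /connect1.
  have npy : ~~ p y k by apply: contra nyk => /connect1.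
  case: (color3 C x k) => xk; first by rewrite xk in npx.
    case: (color3 C y k) => yk; first by rewrite yk in npy.
      by rewrite (col_trim C xk yk pxy).
    by case: (col_rainbow C pxy xk yk).
  case: (color3 C y k) => yk; first by rewrite yk in npy.
    by case: (col_rainbow C (pC C pxy) yk xk).
  by rewrite xk yk.
have [i j k||] := primes [set y | connect p a y].
- rewrite !inE => /connectP[q pq ->] /connectP[r pr ->] nak.
  by rewrite !pathE.
- by move/setP/(_ a); rewrite !inE connect0.
- case=> [/eqP/cards1P[w aw]|compT].
    have xE x : connect p a x -> x = w.
      by move: (aw) => /setP/(_ x); rewrite !inE => -> /eqP.
    have := col_supp C a b; rewrite pab (xE a (connect0 _ _)) (xE b (connect1 pab)).
    by rewrite (col_diag C) eqxx.
  apply/connP => X /set0Pn[x xX] /properP[_ [y _ yX]].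
  have [/crossedP//|ncr] := boolP (crossed p X (setT :\: X)).
  have clX : closed p X.
    apply: intro_closed; first exact: (sym_connect_sym (col_symp C)).
    move=> c d pcd cX; apply/negPn/negP => dX.
    by case/crossedP: ncr; exists c, d; rewrite in_setD dX in_setT.
  have aX z : (a \in X) = (z \in X).
    by apply: (closed_connect clX); have := in_setT z; rewrite -compT inE.
  by move: yX; rewrite -aX (aX x) xX.
Qed.

Lemma prime_monochromatic (p m : rel T) a b c d :
  coloring s p m -> prime_skew -> (2 < #|T|)%N -> p a b -> m c d -> False.
Proof.
move=> C primes T2 pab mcd; have C' := coloring_swap C.
have pT := conn_setT C primes pab; have mT := conn_setT C' primes mcd.
have [|W [pW mW cW]] := P4_cut C (has_P4_of_conn C pT mT _).
  by rewrite cardsT ltnW.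
have [u [X [Y [u0 [X0 Y0 sXY] XYT]]]] := has_cut_setT C primes pW mW cW.
have inXY z : (z \in X) || (z \in Y) by rewrite -in_setU XYT in_setT.
have nXY z : z \in X -> z \in Y -> False.
  by move=> zX zY; case/eqP: u0; rewrite -(sXY z z zX zY) (col_diag C).
have [x xX] := set0Pn _ X0; have [y yY] := set0Pn _ Y0.
(* The sides are disjoint because the diagonal of [s] is zero. Both are clans, hence singletons,
   which leaves only two vertices. *)
have X1 : #|X| = 1%N.
  have [i j k iX jX kX||[//|XT]] := primes X.
  - have kY : k \in Y by have := inXY k; rewrite (negPf kX).
    by rewrite !sXY.
  - by move=> XE; rewrite XE inE in xX.
  - by case: (nXY y); rewrite // XT in_setT.
have Y1 : #|Y| = 1%N.
  have [i j k iY jY kY||[//|YT]] := primes Y.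
  - have kX : k \in X by have := inXY k; rewrite (negPf kY) orbF.
    by rewrite (col_skew C) [RHS](col_skew C) !sXY.
  - by move=> YE; rewrite YE inE in yY.
  - by case: (nXY x); rewrite // YT in_setT.
have := cardsUI X Y; rewrite XYT cardsT X1 Y1 => cE.
by have := leq_addr #|X :&: Y| #|T|; rewrite cE leqNgt T2.
Qed.

End Growth.

(** * Minors of order at most four *)

(** Two enumerations of one set differ by a permutation applied to both rows and columns, whose
    signs cancel. *)
Lemma det_mxsub_im (R : comPzRingType) (T : finType) (F : T -> T -> R) k l
    (f : 'I_k -> T) (g : 'I_l -> T) :
  injective f -> injective g -> f @: setT = g @: setT ->
  \det (\matrix_(i, j) F (f i) (f j)) = \det (\matrix_(i, j) F (g i) (g j)).
Proof.
move=> injf injg fg; have kl : k = l.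
  have := congr1 (fun A : {set T} => #|A|) fg.
  by rewrite !card_imset // !cardsT !card_ord.
case: l / kl g injg fg => g injg fg.
have gf i : exists j, g j == f i.
  have : f i \in g @: setT by rewrite -fg imset_f.
  by case/imsetP => j _ ->; exists j.
pose h i := xchoose (gf i).
have hE i : g (h i) = f i by apply/eqP; exact: (xchooseP (gf i)).
have injh : injective h by move=> i j hij; apply: injf; rewrite -!hE hij.
have -> : \matrix_(i, j) F (f i) (f j) =
    row_perm (perm injh) (col_perm (perm injh) (\matrix_(i, j) F (g i) (g j))).
  by apply/matrixP => i j; rewrite !mxE !permE !hE.
rewrite row_permE col_permE !det_mulmx !det_perm odd_permV mulrC -mulrA -signr_addb.
by rewrite addbb mulr1.
Qed.

Lemma principal_minor_tuple (R : realType) n (M : 'M[R]_n) k (t : k.-tuple 'I_n) :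
  uniq t ->
  principal_minor M [set i in t] = \det (\matrix_(i, j) M (tnth t i) (tnth t j)).
Proof.
move=> /tuple_uniqP ut; apply: det_mxsub_im ut _; first exact: enum_val_inj.
apply/setP => x; apply/imsetP/imsetP => -[i _ ->].
  by have := enum_valP i; rewrite inE => /tnthP[j ->]; exists j.
have xt : tnth t i \in [set j in t] by rewrite inE mem_tnth.
by exists (enum_rank_in xt (tnth t i)); rewrite ?enum_rankK_in.
Qed.

(** Indexing by natural numbers keeps this form under Laplace expansion and lets the indices
    compute. *)
Definition nat_mx (R : Type) (F : nat -> nat -> R) k : 'M[R]_k :=
  \matrix_(i, j) F i j.

Lemma det_nat_expand (R : comPzRingType) (F : nat -> nat -> R) k :
  \det (nat_mx F k.+1) =
  \sum_(j < k.+1) (-1) ^+ j * F 0%N j *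
    \det (nat_mx (fun i l => F i.+1 (bump j l)) k).
Proof.
rewrite (expand_det_row _ ord0); apply: eq_bigr => j _.
rewrite /cofactor mxE add0n mulrCA mulrA; congr (_ * \det _).
by apply/matrixP => i l; rewrite !mxE.
Qed.

Lemma det_nat2 (R : comPzRingType) (F : nat -> nat -> R) :
  \det (nat_mx F 2) = F 0%N 0%N * F 1%N 1%N - F 0%N 1%N * F 1%N 0%N.
Proof.
rewrite det_nat_expand !big_ord_recl big_ord0 !det_mx11 !mxE /bump /=.
by ring.
Qed.

Lemma det_nat3 (R : comPzRingType) (F : nat -> nat -> R) :
  \det (nat_mx F 3) =
    F 0%N 0%N * (F 1%N 1%N * F 2%N 2%N - F 1%N 2%N * F 2%N 1%N)
  - F 0%N 1%N * (F 1%N 0%N * F 2%N 2%N - F 1%N 2%N * F 2%N 0%N)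
  + F 0%N 2%N * (F 1%N 0%N * F 2%N 1%N - F 1%N 1%N * F 2%N 0%N).
Proof.
rewrite det_nat_expand !big_ord_recl big_ord0 /=.
rewrite !det_nat2 /bump /=.
by ring.
Qed.

Lemma det_nat4 (R : comPzRingType) (F : nat -> nat -> R) :
  \det (nat_mx F 4) =
  let G a b c :=
    F 1%N a * (F 2%N b * F 3%N c - F 2%N c * F 3%N b)
  - F 1%N b * (F 2%N a * F 3%N c - F 2%N c * F 3%N a)
  + F 1%N c * (F 2%N a * F 3%N b - F 2%N b * F 3%N a) in
  F 0%N 0%N * G 1%N 2%N 3%N - F 0%N 1%N * G 0%N 2%N 3%N
  + F 0%N 2%N * G 0%N 1%N 3%N - F 0%N 3%N * G 0%N 1%N 2%N.
Proof.
rewrite det_nat_expand !big_ord_recl big_ord0 /=.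
rewrite !det_nat3 /bump /=.
by ring.
Qed.

(** * The coloring of a pair of tournament matrices *)

Section Tournament.

Variables (R : realType) (n : nat).
Implicit Types (M : 'M[R]_n) (i j k l : 'I_n).

Definition skew_part M i j : R := M i j - M j i.

Lemma tournament_diag M i : gen_tournament M -> M i i = 0.
Proof. by case=> _ /(_ i i); rewrite eqxx => ?; lra. Qed.

Lemma tournamentC M i j : gen_tournament M -> i != j -> M j i = 1 - M i j.
Proof. by case=> _ /(_ i j) + ij; rewrite (negPf ij) => ?; lra. Qed.

Lemma principal_minor_nth M (x0 : 'I_n) (k : nat) (t : k.-tuple 'I_n) : uniq t ->
  principal_minor M [set i in t] =
  \det (nat_mx (fun a b => M (nth x0 t a) (nth x0 t b)) k).
Proof.
move=> ut; rewrite principal_minor_tuple //; congr (\det _).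
by apply/matrixP => i j; rewrite !mxE !(tnth_nth x0).
Qed.

(** Off the diagonal [M i j] is [(1 + skew_part M i j) / 2]; the factors 4 and 16 clear denominators
    here and for orders 3 and 4. *)
Lemma minor2 M i j : gen_tournament M -> uniq [:: i; j] ->
  4%:R * principal_minor M [set x in [tuple i; j]] = skew_part M i j ^+ 2 - 1.
Proof.
move=> MT ut; rewrite (@principal_minor_nth M i _ [tuple i; j] ut).
rewrite det_nat2 /= /skew_part.
move: ut; rewrite /= !inE !andbT => ij.
rewrite !(tournament_diag _ MT) (tournamentC MT ij).
by ring.
Qed.

Definition cyc3 (s : 'I_n -> 'I_n -> R) i j k : R :=
  s i j * s j k + s j k * s k i + s k i * s i j.

Lemma minor3 M i j k (s := skew_part M) : gen_tournament M -> uniq [:: i; j; k] ->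
  4%:R * principal_minor M [set x in [tuple i; j; k]] =
  1 + cyc3 s i j k.
Proof.
move=> MT ut; rewrite (@principal_minor_nth M i _ [tuple i; j; k] ut).
rewrite det_nat3 /= /cyc3 /s /skew_part.
move: ut; rewrite /= !inE !negb_or !andbT => /andP[/andP[ij ik] jk].
rewrite !(tournament_diag _ MT) (tournamentC MT ij) (tournamentC MT ik)
  (tournamentC MT jk).
by ring.
Qed.

(** The Pfaffian of the skew matrix of order 4 on [i], [j], [k], [l]. *)
Definition pf4 (s : 'I_n -> 'I_n -> R) i j k l : R :=
  s i j * s k l - s i k * s j l + s i l * s j k.

Lemma minor4 M i j k l (s := skew_part M) : gen_tournament M ->
  uniq [:: i; j; k; l] ->
  16%:R * principal_minor M [set x in [tuple i; j; k; l]] =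
  pf4 s i j k l ^+ 2 - 3%:R
  - (s i j ^+ 2 + s i k ^+ 2 + s i l ^+ 2 + s j k ^+ 2 + s j l ^+ 2 + s k l ^+ 2)
  - 2%:R * (cyc3 s i j k + cyc3 s i j l + cyc3 s i k l + cyc3 s j k l).
Proof.
move=> MT ut; rewrite (@principal_minor_nth M i _ [tuple i; j; k; l] ut).
rewrite det_nat4 /= /pf4 /cyc3 /s /skew_part.
move: ut; rewrite /= !inE !negb_or !andbT.
move=> /andP[/and3P[ij ik il] /andP[/andP[jk jl] kl]].
rewrite !(tournament_diag _ MT) (tournamentC MT ij) (tournamentC MT ik)
  (tournamentC MT jk) (tournamentC MT il) (tournamentC MT jl) (tournamentC MT kl).
by ring.
Qed.

(** * Consequences of equal minors for the skew parts *)

Variables A B : 'M[R]_n.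
Hypothesis AT : gen_tournament A.
Hypothesis BT : gen_tournament B.
Hypothesis minorE : forall X : {set 'I_n}, (#|X| <= 4)%N ->
  principal_minor A X = principal_minor B X.

Let s := skew_part A.
Let t := skew_part B.

Lemma minor_tupleE (k : nat) (u : k.-tuple 'I_n) : (k <= 4)%N ->
  principal_minor A [set x in u] = principal_minor B [set x in u].
Proof.
move=> k4; apply: minorE; rewrite cardsE; apply: leq_trans k4.
by rewrite -{2}(size_tuple u) card_size.
Qed.

Lemma skew_sqr i j : s i j ^+ 2 = t i j ^+ 2.
Proof.
have [<-|ij] := eqVneq i j; first by rewrite /s /t /skew_part !subrr.
have ut : uniq [:: i; j] by rewrite /= inE ij.
apply: (addIr (- 1)); rewrite -(minor2 AT ut) -(minor2 BT ut).
by rewrite minor_tupleE.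
Qed.

Lemma skew_cyc3 i j k : uniq [:: i; j; k] -> cyc3 s i j k = cyc3 t i j k.
Proof.
move=> ut; apply: (addrI 1); rewrite -(minor3 AT ut) -(minor3 BT ut).
by rewrite minor_tupleE.
Qed.

(** All other terms of [minor4] are fixed by the minors of orders 2 and 3. *)
Lemma skew_pf4 i j k l : uniq [:: i; j; k; l] ->
  pf4 s i j k l ^+ 2 = pf4 t i j k l ^+ 2.
Proof.
move=> ut; have := minor4 AT ut; rewrite minor_tupleE // (minor4 BT ut) -/s -/t.
rewrite !skew_sqr (skew_cyc3 (mask_uniq ut [:: true; true; true]))
  (skew_cyc3 (mask_uniq ut [:: true; true; false; true]))
  (skew_cyc3 (mask_uniq ut [:: true; false; true; true]))
  (skew_cyc3 (mask_uniq ut [:: false; true; true; true])).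
by move=> h; lra.
Qed.

Lemma skewN i j : s i j = - s j i /\ t i j = - t j i.
Proof. by rewrite /s /t /skew_part !opprB. Qed.

Lemma skew_neq i j : s i j != 0 -> i != j.
Proof. by move=> sij; apply: contraNneq sij => <-; rewrite /s /skew_part subrr. Qed.

Lemma skew_neqC i j : s i j != 0 -> s j i != 0.
Proof. by have [-> _] := skewN j i; rewrite oppr_eq0. Qed.

Lemma twinC (e : R) i j : t i j = e * s i j -> t j i = e * s j i.
Proof. by have [-> ->] := skewN j i; move=> ->; rewrite mulrN. Qed.

(** From [s] to [t], exactly the two terms of [cyc3] containing [s i j] change sign, so their sum
    vanishes. *)
Lemma skew_odd (e : R) i j k : e ^+ 2 = 1 ->
  s i j != 0 -> s i k != 0 -> s j k != 0 ->
  t i j = - e * s i j -> t i k = e * s i k -> t j k = e * s j k -> s i k = s j k.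
Proof.
move=> e2 sij sik sjk tij tik tjk.
have ut : uniq [:: i; j; k].
  by rewrite /= !inE (negPf (skew_neq sij)) (negPf (skew_neq sik)) (skew_neq sjk).
have := skew_cyc3 ut; have [ski tki] := skewN k i.
rewrite /cyc3 ski tki tij tik tjk => h.
have {}h : s i j * s j k + s j k * - s i k + - s i k * s i j =
    e ^+ 2 * (s i k * s i j - s i j * s j k - s j k * s i k) by rewrite h; ring.
have /eqP : s i j * (s i k - s j k) = 0 by rewrite e2 in h; lra.
by rewrite mulf_eq0 (negPf sij) subr_eq0 => /eqP.
Qed.

(** As [s j k] and [t j k] vanish, [cyc3] reduces to one nonzero product, and it changes sign. *)
Lemma skew_rainbow (e : R) i j k : e ^+ 2 = 1 -> s i j != 0 -> s i k != 0 ->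
  t i j = e * s i j -> t i k = - e * s i k -> s j k = 0 -> False.
Proof.
move=> e2 sij sik tij tik sjk.
have tjk : t j k = 0.
  by apply/eqP; rewrite -sqrf_eq0 -skew_sqr sjk expr0n.
have e0 : e != 0 by apply: contra_eq_neq e2 => ->; rewrite expr0n eq_sym oner_eq0.
have [jk|jk] := eqVneq j k.
  have /eqP : (e *+ 2) * s i k = 0.
    by move: tij; rewrite jk tik mulr2n => h; lra.
  by rewrite mulf_eq0 (negPf sik) mulrn_eq0 (negPf e0).
have ut : uniq [:: i; j; k].
  by rewrite /= !inE (negPf (skew_neq sij)) (negPf (skew_neq sik)) jk.
have := skew_cyc3 ut; have [ski tki] := skewN k i.
rewrite /cyc3 ski tki tij tik tjk sjk => h.
have {}h : - (s i j * s i k) = e ^+ 2 * (s i j * s i k).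
  by apply: etrans (etrans _ h) _; ring.
have /eqP : s i j * s i k = 0 by rewrite e2 in h; lra.
by rewrite mulf_eq0 (negPf sij) (negPf sik).
Qed.

(** Triangles express all six values through [x = s a b] and [y = s a d]. The Pfaffians of [s] and
    [t] become [x^2 - y^2 - x y] and [x^2 - y^2 + x y], and equality of their squares gives
    [x y (x^2 - y^2) = 0]. *)
Lemma skew_path (e : R) a b c d : e ^+ 2 = 1 ->
  s a b != 0 -> s b c != 0 -> s c d != 0 ->
  s a c != 0 -> s b d != 0 -> s a d != 0 ->
  t a b = e * s a b -> t b c = e * s b c -> t c d = e * s c d ->
  t a c = - e * s a c -> t b d = - e * s b d -> t a d = - e * s a d ->
  s a d = s a b \/ s a d = - s a b.
Proof.
move=> e2 ab bc cd ac bd ad tab tbc tcd tac tbd tad.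
have Ne2 : (- e) ^+ 2 = 1 by rewrite sqrrN.
have tabN : t a b = - - e * s a b by rewrite opprK.
have tcdN : t c d = - - e * s c d by rewrite opprK.
have ut : uniq [:: a; b; c; d].
  rewrite /= !inE (negPf (skew_neq ab)) (negPf (skew_neq ac)) (negPf (skew_neq ad)).
  by rewrite (negPf (skew_neq bc)) (negPf (skew_neq bd)) (negPf (skew_neq cd)).
have sbc : s b c = - s a b.
  have [-> _] := skewN b c; congr (- _); apply: esym.
  by apply: (@skew_odd e) => //; [exact: skew_neqC | exact: twinC].
have scd : s c d = s a b.
  have [-> _] := skewN c d; rewrite -[RHS]opprK -sbc; congr (- _); apply: esym.
  by apply: (@skew_odd e) => //; [exact: skew_neqC | exact: twinC].
have sbd : s b d = s a d by apply: esym; apply: (@skew_odd (- e)).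
have sac : s a c = s a d.
  have [-> _] := skewN a c; have [-> _] := skewN a d; congr (- _).
  by apply: (@skew_odd (- e)) => //; try exact: skew_neqC; apply: twinC.
have := skew_pf4 ut.
rewrite /pf4 tab tbc tcd tac tbd tad sbc scd sbd sac => h.
have {}h : (s a b * s a b - s a d * s a d + s a d * - s a b) ^+ 2 =
  (e ^+ 2) ^+ 2 * (s a b * s a b - s a d * s a d + s a d * s a b) ^+ 2.
  by rewrite h; ring.
have /eqP : s a b * s a d * (s a d ^+ 2 - s a b ^+ 2) = 0.
  by rewrite e2 expr1n mul1r in h; lra.
rewrite !mulf_eq0 (negPf ab) (negPf ad) /= subr_eq0 eqf_sqr.
by case/orP => /eqP ->; [left | right].
Qed.

Definition agree (e : R) i j : bool := (s i j != 0) && (t i j == e * s i j).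

Lemma agreeP (e : R) i j : reflect (s i j != 0 /\ t i j = e * s i j) (agree e i j).
Proof. by apply: (iffP andP) => -[? /eqP]. Qed.

Lemma agreeC (e : R) : symmetric (agree e).
Proof.
by move=> i j; apply/agreeP/agreeP => -[/skew_neqC ? /twinC].
Qed.

Lemma skew_coloring : coloring s (agree 1) (agree (- 1)).
Proof.
have e2 : 1 ^+ 2 = 1 :> R by rewrite expr1n.
have Ne2 : (- 1) ^+ 2 = 1 :> R by rewrite sqrrN expr1n.
split.
- by move=> i j; have [] := skewN i j.
- by move=> i; rewrite /s /skew_part subrr.
- exact: agreeC.
- exact: agreeC.
- move=> i j /agreeP[sij tij] /agreeP[_]; rewrite tij => h.
  by move/eqP: sij; apply; lra.
- move=> i j; rewrite /agree; case: eqVneq => //= sij.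
  by rewrite mul1r mulN1r -eqf_sqr -skew_sqr eqxx.
- move=> i j k /agreeP[sij tij] /agreeP[sik tik].
  exact: (skew_rainbow e2 sij sik tij tik).
- move=> i j k /agreeP[sik tik] /agreeP[sjk tjk] /agreeP[sij tij].
  exact: (skew_odd e2 sij sik sjk tij tik tjk).
- move=> i j k /agreeP[sik tik] /agreeP[sjk tjk] /agreeP[sij tij].
  by apply: (skew_odd Ne2 sij sik sjk _ tik tjk); rewrite opprK.
- move=> a b c d /agreeP[ab tab] /agreeP[bc tbc] /agreeP[cd tcd].
  move=> /agreeP[ac tac] /agreeP[bd tbd] /agreeP[ad tad].
  exact: (skew_path e2 ab bc cd ac bd ad tab tbc tcd tac tbd tad).
- move=> a b c d /agreeP[ab tab] /agreeP[bc tbc] /agreeP[cd tcd].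
  move=> /agreeP[ac tac] /agreeP[bd tbd] /agreeP[ad tad].
  by apply: (skew_path Ne2 ab bc cd ac bd ad tab tbc tcd); rewrite opprK.
Qed.

Lemma prime_skew_part : indecomposable A -> prime_skew s.
Proof.
move=> indA X Xs; apply: indA => i j k iX jX kX.
have ik : i != k by apply: contraNneq kX => <-.
have jk : j != k by apply: contraNneq kX => <-.
have := Xs i j k iX jX kX.
rewrite /s /skew_part (tournamentC AT ik) (tournamentC AT jk).
by move=> h; split; lra.
Qed.

Lemma skew_part_inj M N : gen_tournament M -> gen_tournament N ->
  (forall i j, skew_part M i j = skew_part N i j) -> M = N.
Proof.
move=> MT NT h; apply/matrixP => i j; have := h i j; rewrite /skew_part.
have [<-|ij] := eqVneq i j; first by rewrite !tournament_diag.
by rewrite (tournamentC MT ij) (tournamentC NT ij) => ?; lra.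
Qed.

End Tournament.

Theorem theorem4p1 (R : realType) (n : nat) (A B : 'M[R]_n) :
  (4 <= n)%N ->
  gen_tournament A -> gen_tournament B ->
  indecomposable A ->
  (forall X : {set 'I_n}, (#|X| <= 4)%N ->
     principal_minor A X = principal_minor B X) ->
  A = B \/ A = B^T.
Proof.
move=> n4 AT BT indA minorE.
have C := skew_coloring AT BT minorE; have primes := prime_skew_part AT indA.
have BTT : gen_tournament B^T.
  by case: BT => B0 B1; split=> i j; rewrite !mxE // B1 eq_sym.
(* One pair of color [p] excludes color [m] everywhere, so the skew parts of [A] and [B] agree.
   Without such a pair they are opposite, and transposing [B] negates its skew part. *)
have [/existsP[a /existsP[b pab]]|np] :=
  boolP [exists a, exists b, agree A B 1 a b].
  left; apply: skew_part_inj => // i j.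
  case: (color3 C i j) => [/agreeP[_ ->]|mij|sij]; first by rewrite mul1r.
    have T2 : (2 < #|'I_n|)%N by rewrite card_ord ltnW.
    by case: (prime_monochromatic C primes T2 pab mij).
  by apply/eqP; rewrite sij eq_sym -sqrf_eq0 -(skew_sqr AT BT minorE) sij expr0n.
right; apply: skew_part_inj => // i j.
have -> : skew_part B^T i j = - skew_part B i j by rewrite /skew_part !mxE opprB.
case: (color3 C i j) => [pij|/agreeP[_ ->]|sij]; last 2 first.
- by rewrite mulN1r opprK.
- apply/eqP; rewrite sij eq_sym oppr_eq0 -sqrf_eq0 -(skew_sqr AT BT minorE).
  by rewrite sij expr0n.
by case/existsP: np; exists i; apply/existsP; exists j.
Qed.
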